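(* Let $\sigma\in\mathfrak{S}_n$ and let $R=R(\sigma)$. Then $\sigma$ is the unique preimage of $R$ under Patience Sorting (i.e. $R(\tau)=R$ implies $\tau=\sigma$ for $\tau\in\mathfrak{S}_n$) if and only if $\sigma\in S_n(3\mathrm{-}\bar{1}\mathrm{-}42,\,3\mathrm{-}\bar{1}\mathrm{-}24)$.
   Context: Patience Sorting: given $\sigma=\sigma_1\cdots\sigma_n\in\mathfrak{S}_n$, process $\sigma_1,\dots,\sigma_n$ in order, maintaining a left-to-right sequence of piles; $\sigma_1$ starts the first pile; each subsequent card is placed on top of the leftmost pile whose current top card is larger than it, and if no such pile exists it starts a new pile to the right. $R(\sigma)$ is the resulting sequence of piles. $S_n(\pi,\pi')$ is the set of permutations in $\mathfrak{S}_n$ avoiding both $\pi$ and $\pi'$. $\sigma$ contains $3\mathrm{-}\bar{1}\mathrm{-}42$ if there are indices $i<j<n$ with $\sigma_{j+1}<\sigma_i<\sigma_j$ and no $k$ with $i<k<j$, $\sigma_k<\sigma_{j+1}$. $\sigma$ contains $3\mathrm{-}\bar{1}\mathrm{-}24$ if there are indices $i<j<n$ with $\sigma_j<\sigma_i<\sigma_{j+1}$ and no $k$ with $i<k<j$, $\sigma_k<\sigma_j$. Avoiding means not containing. *)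

(* Defs.v *)
From mathcomp Require Import all_boot all_fingroup.

Set Implicit Arguments.
Unset Strict Implicit.
Unset Printing Implicit Defensive.

(* Permutations of {1, .., n} are represented by 'S_n, i.e. permutations of
   {0, .., n - 1}: both positions and values are shifted down by one. *)

Definition word (n : nat) (s : 'S_n) : seq nat :=
  [seq val (s i) | i <- enum 'I_n].

(* A pile is the list of its cards, top card first. *)
Definition top_gt (x : nat) (p : seq nat) : bool :=
  if p is t :: _ then x < t else false.

Fixpoint place (ps : seq (seq nat)) (x : nat) : seq (seq nat) :=
  if ps is p :: ps' then
    if top_gt x p then (x :: p) :: ps' else p :: place ps' x
  else [:: [:: x]].

Definition patience (w : seq nat) : seq (seq nat) := foldl place [::] w.

Definition R (n : nat) (s : 'S_n) : seq (seq nat) := patience (word s).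

(* A pattern is represented by the predicate "s contains the pattern". In the
   two predicates below j' is the position immediately after j. *)

Definition contains_3_bar1_42 (n : nat) (s : 'S_n) : bool :=
  [exists i : 'I_n, exists j : 'I_n, exists j' : 'I_n,
    [&& i < j, val j' == j.+1, s j' < s i, s i < s j
      & ~~ [exists k : 'I_n, [&& i < k, k < j & s k < s j']]]].

Definition contains_3_bar1_24 (n : nat) (s : 'S_n) : bool :=
  [exists i : 'I_n, exists j : 'I_n, exists j' : 'I_n,
    [&& i < j, val j' == j.+1, s j < s i, s i < s j'
      & ~~ [exists k : 'I_n, [&& i < k, k < j & s k < s j]]]].

Definition avoiders2 (n : nat) (P Q : pred 'S_n) : {set 'S_n} :=
  [set s | ~~ P s & ~~ Q s].

(* Main.v *)
Require Import Defs.
From mathcomp Require Import all_boot all_fingroup.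
From mathcomp Require Import zify.

Set Implicit Arguments.
Unset Strict Implicit.
Unset Printing Implicit Defensive.

(* Two consecutive cards commute as soon as they would, from the current state,
   go to different piles.  If two words with the same letters yield the same
   piles, then at their first difference the card [b] played by the second word
   must, in the first word, wait for its turn without its pile being touched, so
   its predecessor there commutes with it.  Hence a word is the unique preimage
   of its piles iff no two consecutive cards commute.  A pattern occurrence
   always commutes; conversely the first commuting pair is a pattern
   occurrence, the card [3] being the top that separates the two destinations:
   a card [1] after it would produce an earlier commuting pair. *)

(** * Placing one card: destinations and commutation *)

Definition dest (P : seq (seq nat)) (x : nat) : nat := find (top_gt x) P.

(** If no pile accepts [x], then [dest P x] is [size P], and [set_nth] with the default pile [[::]]
    appends the new pile [[:: x]]. *)
Lemma placeE P x :
  place P x = set_nth [::] P (dest P x) (x :: nth [::] P (dest P x)).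
Proof. by elim: P => //= p P IH; rewrite /dest /=; case: ifP => //= _; rewrite IH. Qed.

Lemma nth_place P x D :
  nth [::] (place P x) D =
  if D == dest P x then x :: nth [::] P D else nth [::] P D.
Proof. by rewrite placeE nth_set_nth /=; case: eqP => // ->. Qed.

Lemma top_le_before_dest P x D t q :
  D < dest P x -> nth [::] P D = t :: q -> t <= x.
Proof. by move=> /(before_find [::]) + e; rewrite e /= => /negbT; rewrite -leqNgt. Qed.

Lemma dest_le_top P x D t q : nth [::] P D = t :: q -> x < t -> dest P x <= D.
Proof.
move=> e lt; rewrite leqNgt; apply/negP => /top_le_before_dest /(_ e).
by rewrite leqNgt lt.
Qed.

Lemma dest_top P x :
  dest P x < size P -> exists t q, nth [::] P (dest P x) = t :: q /\ x < t.
Proof.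
rewrite /dest -has_find => /(nth_find [::]).
by case: (nth _ _ _) => //= t q lt; exists t, q.
Qed.

Lemma dest_size P x : dest P x <= size P.
Proof. exact: find_size. Qed.

Lemma leq_dest P x y : x <= y -> dest P x <= dest P y.
Proof. by move=> le; apply: sub_find => -[|t p] //=; apply: leq_ltn_trans. Qed.

(** Only the pile receiving [c] changes. If it lies right of the destination of [b], it is
    irrelevant to [b]; if it lies left, its old top is at most [b], so the smaller new top [c] still
    refuses [b]. *)
Lemma dest_place_neq P b c :
  dest P c != dest P b -> dest (place P c) b = dest P b.
Proof.
rewrite /dest; elim: P => [|p P IH] //=.
case: ifP => tc; case: ifP => tb //=; last by rewrite tb eqSS => /IH->.
- by case: p tc tb => //= t p tc tb _; case: ifP => // lt; rewrite (ltn_trans lt tc) in tb.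
- by rewrite tb.
Qed.

Lemma place_comm P x y :
  dest P x != dest P y -> place (place P x) y = place (place P y) x.
Proof.
move=> ne; have ne' : dest P y != dest P x by rewrite eq_sym.
rewrite (placeE (place P x)) (placeE (place P y)) !dest_place_neq //.
rewrite !nth_place (negPf ne) (negPf ne') !placeE set_set_nth (negPf ne).
by [].
Qed.

(** * Comparison of two words with the same piles *)

Lemma suffix_foldl_place P w D :
  suffix (nth [::] P D) (nth [::] (foldl place P w) D).
Proof.
elim: w P => [|x w IH] P /=; first exact: suffix_refl.
apply: suffix_trans (IH _); rewrite nth_place; case: eqP => _; last exact: suffix_refl.
exact: suffix_suffix [:: x] _.
Qed.

Lemma suffix_cons_inj (T : eqType) (b c : T) p q :
  suffix (b :: p) q -> suffix (c :: p) q -> b = c.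
Proof.
move=> /suffixP[r ->] /suffixP[r' e].
have /eqP := congr1 size e; rewrite !size_cat /= eqn_add2r => /eqP er.
by move/eqP: e; rewrite eqseq_cat ?er // => /andP[_ /eqP[]].
Qed.

(** The first card of [u] sent to the pile of [b] would stay directly on its present content, a
    place that the final pile gives to [b], and [b] is not in [u]. *)
Lemma untouched P b u v :
    b \notin u ->
    suffix (b :: nth [::] P (dest P b))
           (nth [::] (foldl place P (u ++ v)) (dest P b)) ->
  dest (foldl place P u) b = dest P b /\
  nth [::] (foldl place P u) (dest P b) = nth [::] P (dest P b).
Proof.
elim: u P => [|c u IH] P //=; rewrite inE negb_or => /andP[bc bu] sb.
have ne : dest P c != dest P b.
  apply: contra bc => /eqP e; apply/eqP.
  apply: suffix_cons_inj sb _.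
  have := suffix_foldl_place (place P c) (u ++ v) (dest P b).
  by rewrite nth_place e eqxx.
have eD := dest_place_neq ne.
have eN : nth [::] (place P c) (dest P b) = nth [::] P (dest P b).
  by rewrite nth_place eq_sym (negPf ne).
by have := IH (place P c) bu; rewrite eD eN; apply.
Qed.

Lemma commuting_pair P w w' :
    perm_eq w w' -> w != w' -> foldl place P w = foldl place P w' ->
  exists u x y v, w = u ++ x :: y :: v /\
    dest (foldl place P u) x != dest (foldl place P u) y.
Proof.
elim: w w' P => [|a w IH] [|b w'] P //=.
- by move=> /perm_size.
- by move=> /perm_size.
have [<-|ab] := eqVneq a b.
  rewrite perm_cons eqseq_cons eqxx /= => pw ne eR.
  have [u [x [y [v [-> dxy]]]]] := IH _ _ pw ne eR.
  by exists (a :: u), x, y, v.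
move=> pw _ eR.
have bw : b \in w.
  by have := perm_mem pw b; rewrite !inE eqxx eq_sym (negPf ab).
pose w1 := take (index b w) w; pose v := drop (index b w).+1 w.
have ew : a :: w = (a :: w1) ++ b :: v.
  by rewrite /= -[b in b :: v](nth_index b bw) -drop_nth ?index_mem // cat_take_drop.
have b1 : b \notin a :: w1.
  by rewrite inE negb_or eq_sym ab /= in_take ?ltnn.
(* The second word plays [b] at once, and piles only grow on top. *)
have sb : suffix (b :: nth [::] P (dest P b))
     (nth [::] (foldl place P (a :: w)) (dest P b)).
  rewrite /= eR; have := suffix_foldl_place (place P b) w' (dest P b).
  by rewrite nth_place eqxx.
(* The predecessor [c] of [b] exists because the first letters [a] and [b] differ. *)
move: ew b1; case: (lastP (a :: w1)) => [[/eqP]|u c ew]; first by rewrite (negPf ab).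
rewrite mem_rcons inE negb_or.
move=> /andP[bc bu]; exists u, c, b, v; split; first by rewrite ew cat_rcons.
rewrite ew cat_rcons in sb.
have [dB nB] := untouched bu sb.
(* With equal destinations, [c] would lie where [b] must lie in the final piles. *)
apply: contra bc => /eqP e; apply/eqP.
apply: suffix_cons_inj sb _.
rewrite foldl_cat /=.
have := suffix_foldl_place (place (foldl place P u) c) (b :: v) (dest P b).
by rewrite nth_place e dB eqxx nB.
Qed.

(** * Evolution of the pile tops along a word *)

Definition state (w : seq nat) (m : nat) : seq (seq nat) := patience (take m w).

Lemma stateS w m : m < size w -> state w m.+1 = place (state w m) (nth 0 w m).
Proof. by move=> lt; rewrite /state (take_nth 0 lt) /patience foldl_rcons. Qed.

(** The index [i] is the last time before [m] at which the pile [D] received a card. *)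
Lemma top_history (w : seq nat) m D t q :
    m <= size w -> nth [::] (state w m) D = t :: q ->
  exists i, [/\ i < m, nth 0 w i = t &
    forall l, i < l <= m -> nth [::] (state w l) D = t :: q].
Proof.
elim: m => [|m IH] ltm; first by rewrite /state take0 nth_nil.
rewrite stateS // nth_place; case: eqP => [eD|/eqP neD] e.
  exists m; split=> //; first by case: e.
  move=> l; rewrite -eqn_leq => /eqP <-.
  by rewrite stateS // nth_place eD eqxx -eD.
have [i [im ei H]] := IH (ltnW ltm) e.
exists i; split=> //; first exact: ltnW.
move=> l /andP[il]; rewrite leq_eqVlt => /predU1P[->|lm].
  by rewrite stateS // nth_place (negPf neD).
by apply: H; rewrite il -ltnS.
Qed.

(** A new top is smaller than any top it covers, hence than the tops to its right, and the tops to
    its left have refused it. Distinctness of the letters makes the latter inequality strict. *)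
Lemma tops_increasing (w : seq nat) m D E z p t q :
    uniq w -> m <= size w -> D < E ->
    nth [::] (state w m) D = z :: p -> nth [::] (state w m) E = t :: q ->
  z < t.
Proof.
move=> uw; elim: m D E z p t q => [|m IH] D E z p t q ltm DE.
  by rewrite /state take0 nth_nil.
rewrite stateS // !nth_place; case: eqP => [eD|/eqP neD]; case: eqP => [eE|/eqP neE].
- by move: DE; rewrite eD eE ltnn.
- move=> [<- _] eT.
  have /dest_top[z' [p' [ez ltz]]] : dest (state w m) (nth 0 w m) < size (state w m).
    rewrite -eD; apply: ltn_trans DE _; rewrite ltnNge; apply/negP => le.
    by rewrite nth_default in eT.
  by apply: ltn_trans ltz _; apply: IH DE _ eT; [exact: ltnW | rewrite eD ez].
- move=> eZ [<- _]; rewrite eE in DE.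
  rewrite ltn_neqAle (top_le_before_dest DE eZ) andbT.
  have [i [im ei _]] := top_history (ltnW ltm) eZ.
  by rewrite -ei nth_uniq ?ltn_eqF // (ltn_trans im).
- by apply: IH => //; apply: ltnW.
Qed.

Lemma nth_neq (w : seq nat) i j :
  uniq w -> i < size w -> j < size w -> i != j -> nth 0 w i != nth 0 w j.
Proof. by move=> uw iw jw; rewrite nth_uniq. Qed.

(** * Commuting neighbours and pattern occurrences *)

Definition commuting_at (w : seq nat) (j : nat) : bool :=
  (j.+1 < size w) &&
  (dest (state w j) (nth 0 w j) != dest (state w j) (nth 0 w j.+1)).

(** Both patterns at once: [nth 0 w i] is the card 3, and the order of [a] and [c] in the word tells
    them apart. *)
Definition pattern_at (w : seq nat) (i j : nat) : Prop :=
  let a := minn (nth 0 w j) (nth 0 w j.+1) in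
  let c := maxn (nth 0 w j) (nth 0 w j.+1) in
  [/\ i < j, j.+1 < size w, a < nth 0 w i < c &
      forall k, i < k < j -> a <= nth 0 w k].

(** Until time [j], the pile [D] of the card 3 keeps a top above [a] and at most that card, since no
    card below [a] intervenes. So [a] goes to [D] or further left, whereas [c], larger than all tops
    up to [D], goes further right. *)
Lemma commuting_at_of_pattern (w : seq nat) i j :
  uniq w -> pattern_at w i j -> commuting_at w j.
Proof.
move=> uw; rewrite /pattern_at /commuting_at.
set a := minn _ _; set c := maxn _ _ => -[ij js /andP[ab bc] H].
rewrite js /=.
suff ne : dest (state w j) a != dest (state w j) c.
  by move: ne; rewrite /a /c; case: leqP => // _; rewrite eq_sym.
set D := dest (state w i) (nth 0 w i).
have topD l : i < l <= j ->
    exists t q, nth [::] (state w l) D = t :: q /\ a < t <= nth 0 w i.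
  elim: l => // l IH /andP[il lj].
  have ls : l < size w by lia.
  rewrite stateS // nth_place.
  case: eqP => [eD|neD].
    case: (ltngtP i l) => [il'|il'|eil]; last 1 first.
    - by exists (nth 0 w l), (nth [::] (state w l) D); rewrite -eil ab leqnn.
    - have [|t [q [et /andP[at_ ti]]]] := IH; first by lia.
      exists (nth 0 w l), (nth [::] (state w l) D); split=> //.
      have [|t' [q' []]] := @dest_top (state w l) (nth 0 w l).
        rewrite -eD ltnNge; apply/negP => le.
        by rewrite nth_default in et.
      rewrite -eD et => -[<- _] lt.
      have := H l; rewrite il' lj => /(_ isT) al.
      rewrite (ltnW (leq_trans lt ti)) andbT ltn_neqAle al andbT.
      by rewrite /a; case: leqP => _; apply: nth_neq => //; lia.
    - by lia.
  case: (ltngtP i l) => [il'|il'|eil]; first by apply: IH; lia.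
    by lia.
  by case: neD; rewrite /D eil.
have [|t [q [et /andP[lat lti]]]] := topD j; first by rewrite ij leqnn.
have le1 : dest (state w j) a <= D by apply: dest_le_top et lat.
rewrite neq_ltn; apply/orP; left; apply: leq_ltn_trans le1 _.
have tc : t < c by apply: leq_ltn_trans bc.
rewrite ltnNge; apply/negP => le.
have [|t' [q' [et' lt']]] := @dest_top (state w j) c.
  apply: leq_ltn_trans le _; rewrite ltnNge; apply/negP => le'.
  by rewrite nth_default in et.
move: le; rewrite leq_eqVlt => /predU1P[eD|lt].
  by move: et' lt'; rewrite eD et => -[<- _]; rewrite ltnNge (ltnW tc).
have := tops_increasing uw _ lt et' et; lia.
Qed.

Lemma pattern_of_commuting_at (w : seq nat) j0 :
  uniq w -> commuting_at w j0 -> exists i j, pattern_at w i j.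
Proof.
move=> uw cj; have exj : exists j, commuting_at w j by exists j0.
case: (ex_minnP exj) => j /andP[js nd] minj {j0 cj exj}.
rewrite /pattern_at.
suff [i] : exists i, let a := minn (nth 0 w j) (nth 0 w j.+1) in
  let c := maxn (nth 0 w j) (nth 0 w j.+1) in
  [/\ i < j, a < nth 0 w i < c & forall k, i < k < j -> a <= nth 0 w k].
  by move=> [ij iac H]; exists i, j; split.
set a := minn _ _; set c := maxn _ _.
have {}nd : dest (state w j) a != dest (state w j) c.
  by move: nd; rewrite /a /c; case: leqP => // _; rewrite eq_sym.
have ac : a <= c by rewrite geq_min leq_max leqnn.
have {}nd : dest (state w j) a < dest (state w j) c by rewrite ltn_neqAle nd leq_dest.
(* The top [t] of the pile receiving [a] refuses [c]; the position where [t] was played serves as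
   [i]. *)
have [|t [p [et lat]]] := @dest_top (state w j) a.
  exact: leq_trans nd (dest_size _ _).
have tc := top_le_before_dest nd et.
have [|i [ij ei H]] := top_history _ et; first by lia.
have ltc : t < c.
  rewrite ltn_neqAle tc andbT -ei /c; case: leqP => _; apply: nth_neq => //; lia.
exists i => /=; rewrite ei lat ltc; split=> // k ikj.
rewrite leqNgt; apply/negP => ka.
(* A card below [a] is below [t]. The first position after [i] with a card below [t] will be
   [k1.+1], so the card at [k1] is at least [t]. *)
have exk : exists k, (i < k) && (nth 0 w k < t).
  by exists k; case/andP: ikj => -> _ /=; apply: ltn_trans lat.
case: (ex_minnP exk) => -[//|k1] /andP[ik1 yt] mink.
have k1j : k1.+1 < j.
  by apply: leq_ltn_trans (mink k _) _; case/andP: ikj => // -> _; apply: ltn_trans lat.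
have zt : t <= nth 0 w k1.
  move: ik1; rewrite ltnS leq_eqVlt => /predU1P[<-|lt]; first by rewrite ei.
  rewrite leqNgt; apply/negP => lt'.
  by have := mink k1; rewrite lt lt' ltnn => /(_ isT).
set z := nth 0 w k1 in zt; set y := nth 0 w k1.+1 in yt.
(* Minimality of [j] prevents the pair at [k1] from commuting. *)
have eE : dest (state w k1) z = dest (state w k1) y.
  apply/eqP; apply: contraT => ne.
  have := minj k1; rewrite /commuting_at ne andbT; lia.
have S1 : state w k1.+1 = place (state w k1) z by apply: stateS; lia.
have S2 : state w k1.+2 = place (state w k1.+1) y by apply: stateS; lia.
set D := dest (state w j) a in et H.
have D1 : nth [::] (state w k1.+1) D = t :: p by apply: H; lia.
have D2 : nth [::] (state w k1.+2) D = t :: p by apply: H; lia.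
have DE : D <= dest (state w k1) z.
  rewrite leqNgt; apply/negP => lt.
  have := tops_increasing uw _ lt _ D1.
  rewrite S1 nth_place eqxx => /(_ _ _ _ erefl); lia.
(* The card [y] could go on top of [t], but the pile [D] is untouched between [i] and [j], so [y]
   goes further left. *)
have yD : dest (state w k1.+1) y < D.
  rewrite ltn_neqAle (dest_le_top D1 yt) andbT; apply/eqP => e.
  by move: D2; rewrite S2 nth_place e eqxx => -[ey _]; rewrite -ey ltnn in yt.
have [|t' [q [et' lt']]] := @dest_top (state w k1.+1) y.
  apply: ltn_trans yD _; rewrite ltnNge; apply/negP => le.
  by rewrite nth_default in D1.
(* Left of [D], placing [z] changed nothing, so this pile already accepted [y] before [z] came,
   against [eE] and [DE]. *)
move: et'; rewrite {1}S1 nth_place ltn_eqF ?(leq_trans yD) // => et'.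
by have := dest_le_top et' lt'; rewrite -eE; lia.
Qed.

(** * Permutations and their words *)

Section PermutationWord.

Variable n : nat.
Implicit Types (s t : 'S_n) (i j : 'I_n).

Lemma size_word s : size (word s) = n.
Proof. by rewrite size_map size_enum_ord. Qed.

Lemma nth_word s i : nth 0 (word s) i = s i.
Proof. by rewrite (nth_map i) ?size_enum_ord // nth_ord_enum. Qed.

Lemma word_inj : injective (@word n).
Proof.
by move=> s t e; apply/permP => i; apply/val_inj; rewrite /= -!nth_word e.
Qed.

Lemma uniq_word s : uniq (word s).
Proof. by rewrite map_inj_uniq ?enum_uniq // => i j /val_inj/perm_inj. Qed.

Lemma perm_eq_word s t : perm_eq (word s) (word t).
Proof.
apply: uniq_perm; rewrite ?uniq_word // => x.
have inE' (r : 'S_n) : (x \in word r) = (x < n).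
  apply/mapP/idP => [[i _ ->]|xn]; first exact: ltn_ord.
  by exists ((r^-1)%g (Ordinal xn)); rewrite ?mem_enum // permKV.
by rewrite !inE'.
Qed.

Lemma not_avoiders2P s :
  s \notin avoiders2 (@contains_3_bar1_42 n) (@contains_3_bar1_24 n) <->
  exists i j : nat, pattern_at (word s) i j.
Proof.
rewrite inE negb_and !negbK; split.
  case/orP=> /existsP[i /existsP[j /existsP[j' /and5P[ij /eqP ej lo hi nk]]]];
    exists i, j; split; rewrite ?size_word -?ej ?nth_word //; try exact: ltn_ord; try lia;
    move=> k /andP[ik kj]; have kn : k < n := ltn_trans kj (ltn_ord j);
    rewrite leqNgt; apply: contra nk => lt; apply/existsP; exists (Ordinal kn);
    rewrite /= ik kj -(nth_word s (Ordinal kn)) /=; lia.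
case=> i [j []]; rewrite size_word => ij jn.
have jn' : j < n by lia.
have iN : i < n by lia.
have := nth_word s (Ordinal iN); have := nth_word s (Ordinal jn).
have := nth_word s (Ordinal jn') => /= -> -> -> /andP[lo hi] H.
have Hk (k : 'I_n) : i < k < j ->
    minn (s (Ordinal jn')) (s (Ordinal jn)) <= s k.
  by move/H; rewrite nth_word.
(* A descent gives [contains_3_bar1_42], an ascent [contains_3_bar1_24]; equality would leave no
   room for the card 3 strictly between the two. *)
case: (ltngtP (s (Ordinal jn)) (s (Ordinal jn'))) => lt; last by lia.
- apply/orP; left; apply/existsP; exists (Ordinal iN); apply/existsP.
  exists (Ordinal jn'); apply/existsP; exists (Ordinal jn).
  apply/and5P; split=> //=; try lia.
  apply/existsP => -[k /and3P[/= ik kj sk]]; have := Hk k.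
  by rewrite ik kj (minn_idPr (ltnW lt)) leqNgt sk => /(_ isT).
- apply/orP; right; apply/existsP; exists (Ordinal iN); apply/existsP.
  exists (Ordinal jn'); apply/existsP; exists (Ordinal jn).
  apply/and5P; split=> //=; try lia.
  apply/existsP => -[k /and3P[/= ik kj sk]]; have := Hk k.
  by rewrite ik kj (minn_idPl (ltnW lt)) leqNgt sk => /(_ isT).
Qed.

(** A product of permutations applies its left factor first, so [tperm i j * s] exchanges the
    entries at two positions rather than two values. *)
Lemma swap_word s i j :
    val j = i.+1 ->
  word (tperm i j * s)%g =
  take i (word s) ++ val (s j) :: val (s i) :: drop j.+1 (word s).
Proof.
move=> /= ej; have jn := ltn_ord j; apply: (@eq_from_nth _ 0).
  rewrite size_cat /= size_take size_drop !size_word; case: ltnP; lia.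
move=> k; rewrite size_word => kn.
rewrite (nth_word _ (Ordinal kn)) permM nth_cat size_take size_word ltn_ord.
case: (ltngtP k i) => [ki|ik|ki].
- by rewrite nth_take // (nth_word _ (Ordinal kn)) tpermD // -val_eqE /=; lia.
- case: (ltngtP k j) => [kj|jk|kj]; first by lia.
    rewrite (_ : k - i = (k - j.+1).+2) /=; last by lia.
    rewrite nth_drop subnKC // (nth_word _ (Ordinal kn)) tpermD // -val_eqE /=; lia.
  have -> : Ordinal kn = j by apply: val_inj.
  by rewrite tpermR kj ej subSnn.
- have -> : Ordinal kn = i by apply: val_inj.
  by rewrite tpermL ki subnn.
Qed.

Lemma commuting_pairP s :
  (exists2 t : 'S_n, R t = R s & t <> s) <->
  exists j : nat, commuting_at (word s) j.
Proof.
split=> [[t eR ne]|[j /andP[]]].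
  have [|u [x [y [v [ew d]]]]] :=
    commuting_pair (perm_eq_word s t) _ (esym eR : _ = _).
    by apply/eqP => /word_inj /esym.
  exists (size u); rewrite /commuting_at /state ew take_size_cat // size_cat /=.
  apply/andP; split; first by lia.
  by rewrite !nth_cat ltnn subnn ltnNge leqnSn subSnn.
rewrite size_word => jn; have jn' := ltnW jn.
set i := Ordinal jn'; set j' := Ordinal jn.
rewrite (nth_word s i) (nth_word s j') => d.
(* Exchanging two neighbours that go to different piles leaves the piles unchanged, by
   [place_comm]. *)
exists (tperm i j' * s)%g.
  rewrite /R swap_word // /patience foldl_cat /= -place_comm //.
  rewrite -(nth_word s i) -(nth_word s j').
  have e : word s = take j (word s) ++
      nth 0 (word s) i :: nth 0 (word s) j' :: drop j'.+1 (word s).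
    by rewrite -!drop_nth ?size_word // cat_take_drop.
  by rewrite [in RHS]e foldl_cat.
move/permP/(_ i); rewrite permM tpermL => /perm_inj /(congr1 val) /=; lia.
Qed.

End PermutationWord.

Theorem mainTheorem3 (n : nat) (s : 'S_n) :
  (forall t : 'S_n, R t = R s -> t = s) <->
  s \in avoiders2 (@contains_3_bar1_42 n) (@contains_3_bar1_24 n).
Proof.
have [cs sc] := commuting_pairP s; have [ap pa] := not_avoiders2P s.
split=> [us|av t eR].
  apply: contraT => /ap[i [j /(commuting_at_of_pattern (uniq_word s)) cj]].
  by case: sc => [|t /us]; first by exists j.
apply/eqP; apply: contraT => /eqP ne.
have [|j cj] := cs; first by exists t.
by move: av; apply: contraLR => _; apply: pa; apply: pattern_of_commuting_at cj; apply: uniq_word.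
Qed.
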